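(* Let $(L,q_L)$ be a quadratic lattice of rank $n$ over $\mathfrak{o}$ and $k\ge n$. The morphism of $\mathfrak{o}$-schemes $\rho:\underline{M}^*_{\mathfrak{o}}(L,H_k)\to\underline{Q}_L$, $m\mapsto q_k\circ m$, is smooth.
   Context: $F$ is a finite extension of $\mathbb{Q}_p$ with ring of integers $\mathfrak{o}$. A quadratic lattice is a free $\mathfrak{o}$-module $L$ of rank $n$ with a quadratic form $q_L:L\to\mathfrak{o}$ such that $L\otimes F$ is nondegenerate. $H_k=\mathfrak{o}^{2k}$ with $q_k=\sum_{i=1}^kx_iy_i$. $\underline{M}_{\mathfrak{o}}(L,H_k)$ is the affine space over $\mathfrak{o}$ (of dimension $2kn$) whose $R$-points are the $R$-linear maps $L\otimes R\to H_k\otimes R$; $\underline{M}^*_{\mathfrak{o}}(L,H_k)$ is its open subscheme whose $R$-points are the maps for which at least one $n\times n$ minor is a unit in $R$. $\underline{Q}_L$ is the affine space over $\mathfrak{o}$ of dimension $n(n+1)/2$ whose $R$-points are the quadratic forms on $L\otimes R$ with coefficients in $R$.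
   Formalization: The R-points of M* are taken to be the maps whose n×n minors generate the unit ideal of R; ''at least one minor is a unit'' describes the same open subscheme only for local R and, read literally for all R, defines no scheme. *)

(* Defs.v *)
From HB Require Import structures.
From mathcomp Require Import all_boot all_order all_algebra all_field.
From mathcomp Require Import ring boolp.
From mathcomp.multinomials Require Import mpoly.

Set Implicit Arguments.
Unset Strict Implicit.
Unset Printing Implicit Defensive.

Import Order.TTheory GRing.Theory Num.Theory.
Local Open Scope ring_scope.

(* |r|_p = p ^ (- v_p(r)), with v_p(r) = logn p (numerator) - logn p (denominator) *)
Definition padic_abs (p : nat) (r : rat) : rat :=
  if r == 0 then 0
  else (p%:R : rat) ^ ((logn p `|denq r|)%:Z - (logn p `|numq r|)%:Z).

(* Q_p, characterized up to unique isomorphism as the completion of the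
   rationals for |.|_p: a complete valued field in which the rationals, with
   their p-adic absolute value, are dense.  The absolute value of Q_p has
   rational values. *)
Record padicField (p : nat) := PadicField {
  padic_sort :> fieldType;
  padic_norm : padic_sort -> rat;
  padic_norm_ge0 : forall x, 0 <= padic_norm x;
  padic_norm_eq0 : forall x, padic_norm x = 0 -> x = 0;
  padic_normM : forall x y, padic_norm (x * y) = padic_norm x * padic_norm y;
  padic_normD : forall x y,
    padic_norm (x + y) <= Num.max (padic_norm x) (padic_norm y);
  padic_norm_ratr : forall r : rat, padic_norm (ratr r) = padic_abs p r;
  padic_dense : forall (x : padic_sort) (e : rat), 0 < e ->
    exists r : rat, padic_norm (x - ratr r) < e;
  padic_complete : forall u : nat -> padic_sort,
    (forall e : rat, 0 < e -> exists N : nat, forall i j : nat,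
       (N <= i)%N -> (N <= j)%N -> padic_norm (u i - u j) < e) ->
    exists l : padic_sort, forall e : rat, 0 < e ->
      exists N : nat, forall i : nat, (N <= i)%N -> padic_norm (u i - l) < e
}.

Section PadicIntegers.
Variables (p : nat) (K : padicField p).
Local Notation nm := (@padic_norm p K).

Definition padic_int_pred : {pred K} := fun x => nm x <= 1.

Lemma padic_norm1 : nm 1 = 1.
Proof.
have n0 : nm 1 != 0.
  by apply/eqP => /padic_norm_eq0/eqP; rewrite oner_eq0.
by apply: (mulfI n0); rewrite -padic_normM !mulr1.
Qed.

Lemma padic_normN x : nm (- x) = nm x.
Proof.
have n1 : nm (-1) = 1.
  have : nm (-1) ^+ 2 == 1 by rewrite expr2 -padic_normM mulrNN mulr1 padic_norm1.
  rewrite sqrf_eq1 => /orP[/eqP//|/eqP e].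
  by have := @padic_norm_ge0 p K (-1); rewrite e ler0N1.
by rewrite -mulN1r padic_normM n1 mul1r.
Qed.

Lemma padic_int_subring : subring_closed padic_int_pred.
Proof.
split; rewrite /padic_int_pred.
- by rewrite unfold_in padic_norm1.
- move=> x y; rewrite !unfold_in => hx hy.
  by rewrite (le_trans (padic_normD _ _))// ge_max padic_normN hx hy.
- move=> x y; rewrite !unfold_in => hx hy.
  by rewrite padic_normM mulr_ile1 // padic_norm_ge0.
Qed.

HB.instance Definition _ := GRing.isSubringClosed.Build K padic_int_pred
  padic_int_subring.

Record padic_int := PadicInt { padic_int_val :> K; _ : padic_int_val \in padic_int_pred }.
HB.instance Definition _ := [isSub for padic_int_val].
HB.instance Definition _ := [Choice of padic_int by <:].
HB.instance Definition _ := [SubChoice_isSubComNzRing of padic_int by <:].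

Variable F : fieldExtType K.

Definition Zp_to : {rmorphism padic_int -> F} := in_alg F \o (val : padic_int -> K).

Definition ringint_pred : {pred F} := fun x => `[< integralOver Zp_to x >].

Lemma ringint_subring : subring_closed ringint_pred.
Proof.
split; rewrite /ringint_pred.
- by rewrite unfold_in; apply/asboolP/integral1.
- move=> x y; rewrite !unfold_in => /asboolP hx /asboolP hy.
  by apply/asboolP/integral_sub.
- move=> x y; rewrite !unfold_in => /asboolP hx /asboolP hy.
  by apply/asboolP/integral_mul.
Qed.

HB.instance Definition _ := GRing.isSubringClosed.Build F ringint_pred
  ringint_subring.

Record ringint := RingInt { ringint_val : F; _ : ringint_val \in ringint_pred }.
HB.instance Definition _ := [isSub for ringint_val].
HB.instance Definition _ := [Choice of ringint by <:].
HB.instance Definition _ := [SubChoice_isSubComNzRing of ringint by <:].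

Definition ringint_incl : {rmorphism ringint -> F} := (val : ringint -> F).

End PadicIntegers.

Definition polar (R : comNzRingType) (V : lmodType R) (q : V -> R) (x y : V) : R :=
  q (x + y) - q x - q y.

Definition is_quadform (R : comNzRingType) (V : lmodType R) (q : V -> R) : Prop :=
  (forall (a : R) (x : V), q (a *: x) = a ^+ 2 * q x) /\
  (forall (a : R) (x y z : V),
     polar q (a *: x + y) z = a * polar q x z + polar q y z).

Record quadForm (R : comNzRingType) (V : lmodType R) := QuadForm {
  qf_fun :> V -> R;
  qfP : is_quadform qf_fun
}.

Definition nondegenerate (R : comNzRingType) (V : lmodType R) (q : quadForm V) : Prop :=
  forall x : V, (forall y : V, polar q x y = 0) -> x = 0.

Section QuadForms.
Variable R : comNzRingType.
Implicit Types V W : lmodType R.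

Lemma quadForm_ext V (q q' : quadForm V) : q =1 q' -> q = q'.
Proof.
case: q q' => [q qP] [q' qP'] /= /funext qq'; rewrite qq' in qP *.
by congr QuadForm; apply: Prop_irrelevance.
Qed.

Lemma qf_comp_subproof V W (q : quadForm W) (f : {linear V -> W}) :
  is_quadform (q \o f).
Proof.
case: q => q [qZ qB] /=; split=> [a x|a x y z] /=; first by rewrite linearZ qZ.
have pE u v : polar (q \o f) u v = polar q (f u) (f v) by rewrite /polar /= linearD.
by rewrite !pE linearP qB.
Qed.

Definition qf_comp V W (q : quadForm W) (f : {linear V -> W}) : quadForm V :=
  QuadForm (qf_comp_subproof q f).

Lemma polarC V (q : V -> R) x y : polar q x y = polar q y x.
Proof. by rewrite /polar [x + y]addrC addrAC. Qed.

Lemma polarDl V (q : quadForm V) x y z : polar q (x + y) z = polar q x z + polar q y z.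
Proof. by have := (qfP q).2 1 x y z; rewrite scale1r mul1r. Qed.

Lemma polar0l V (q : quadForm V) z : polar q 0 z = 0.
Proof. by apply: (addIr (polar q 0 z)); rewrite -polarDl !add0r. Qed.

Lemma polarZl V (q : quadForm V) a x z : polar q (a *: x) z = a * polar q x z.
Proof. by have := (qfP q).2 a x 0 z; rewrite addr0 polar0l addr0. Qed.

Lemma polarZr V (q : quadForm V) a x z : polar q x (a *: z) = a * polar q x z.
Proof. by rewrite polarC polarZl polarC. Qed.

Lemma polar_suml V (q : quadForm V) (I : Type) (r : seq I) (x : I -> V) z :
  polar q (\sum_(i <- r) x i) z = \sum_(i <- r) polar q (x i) z.
Proof.
by elim/big_rec2: _ => [|i u v _ <-]; rewrite ?polar0l ?polarDl.
Qed.

Lemma qf0 V (q : quadForm V) : q 0 = 0.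
Proof. by have := (qfP q).1 0 0; rewrite scale0r expr0n mul0r. Qed.

Lemma qfD V (q : quadForm V) x y : q (x + y) = q x + q y + polar q x y.
Proof. by rewrite /polar; ring. Qed.

Lemma is_quadform_sum V (I : Type) (r : seq I) (P : pred I) (q : I -> V -> R) :
  (forall i, is_quadform (q i)) -> is_quadform (fun v => \sum_(i <- r | P i) q i v).
Proof.
move=> qP; split=> [a x|a x y z].
  by rewrite mulr_sumr; apply: eq_bigr => i _; rewrite (qP i).1.
have pE u v : polar (fun v => \sum_(i <- r | P i) q i v) u v
            = \sum_(i <- r | P i) polar (q i) u v.
  by rewrite /polar -!sumrB.
by rewrite !pE mulr_sumr -big_split; apply: eq_bigr => i _; rewrite (qP i).2.
Qed.

Lemma is_quadform_monomial n (c : R) (i j : 'I_n) :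
  is_quadform (fun v : 'rV[R]_n => c * (v 0 i * v 0 j)).
Proof.
split=> [a x|a x y z]; first by rewrite !mxE expr2; ring.
by rewrite /polar !mxE; ring.
Qed.

(* The coefficients of q: q v = \sum_(i <= j) qf_coef q i j * v_i * v_j. *)
Definition qf_coef n (q : quadForm 'rV[R]_n) (i j : 'I_n) : R :=
  if i == j then q (delta_mx 0 i) else polar q (delta_mx 0 i) (delta_mx 0 j).

Lemma qf_sum V (q : quadForm V) n (x : 'I_n -> V) :
  q (\sum_(i < n) x i)
  = \sum_(i < n) \sum_(j < n | (i <= j)%N)
      if i == j then q (x i) else polar q (x i) (x j).
Proof.
elim: n x => [|n IH] x; first by rewrite !big_ord0 qf0.
rewrite !big_ord_recr /= qfD IH polar_suml.
rewrite [X in _ = _ + X](big_pred1 ord_max) => [|j /=]; last first.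
  by rewrite -val_eqE /= eqn_leq -[(j <= n)%N]ltnS ltn_ord.
rewrite eqxx addrAC -big_split /=; congr (_ + _); apply: eq_bigr => i _.
rewrite [RHS]big_mkcond big_ord_recr /= -big_mkcond /= [(i <= n)%N]ltnW //.
by rewrite -[_ == ord_max]val_eqE /= ltn_eqF.
Qed.

Lemma qfE n (q : quadForm 'rV[R]_n) v :
  q v = \sum_(i < n) \sum_(j < n | (i <= j)%N) qf_coef q i j * (v 0 i * v 0 j).
Proof.
rewrite {1}[v]row_sum_delta qf_sum; apply: eq_bigr => i _; apply: eq_bigr => j _.
rewrite /qf_coef; case: eqP => [<-|_]; first by rewrite (qfP q).1 mulrC expr2.
by rewrite polarZl polarZr mulrA mulrC.
Qed.

Lemma qf_eq_coef n (q q' : quadForm 'rV[R]_n) :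
  (forall i j : 'I_n, (i <= j)%N -> qf_coef q i j = qf_coef q' i j) -> q = q'.
Proof.
move=> e; apply: quadForm_ext => v; rewrite !qfE.
by apply: eq_bigr => i _; apply: eq_bigr => j ij; rewrite e.
Qed.

End QuadForms.

Section BaseChange.
Variables (R S : comNzRingType) (f : {rmorphism R -> S}) (n : nat).

Lemma qf_map_subproof (q : quadForm 'rV[R]_n) :
  is_quadform (fun v : 'rV[S]_n => \sum_(i < n) \sum_(j < n | (i <= j)%N)
                 f (qf_coef q i j) * (v 0 i * v 0 j)).
Proof. by do 2!apply: is_quadform_sum => ?; apply: is_quadform_monomial. Qed.

Definition qf_map (q : quadForm 'rV[R]_n) : quadForm 'rV[S]_n :=
  QuadForm (qf_map_subproof q).

Lemma qf_map_coef (q : quadForm 'rV[R]_n) (i j : 'I_n) :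
  (i <= j)%N -> qf_coef (qf_map q) i j = f (qf_coef q i j).
Proof.
have sum_delta (a b : 'I_n) (c : 'I_n -> 'I_n -> S) : (a <= b)%N ->
    \sum_(k < n) \sum_(l < n | (k <= l)%N)
      c k l * ((k == a)%:R * (l == b)%:R) = c a b.
  move=> ab; rewrite (bigD1 a) //= [X in _ + X]big1 ?addr0 => [|k ka]; last first.
    by rewrite big1 // => l _; rewrite (negPf ka) mul0r mulr0.
  rewrite (bigD1 b) //= big1 ?addr0 ?eqxx ?mulr1 // => l /andP[_ lb].
  by rewrite (negPf lb) !mulr0.
move=> ij; rewrite {1}/qf_coef; case: eqP => [<-|/eqP nij].
  rewrite /= -[RHS](sum_delta i i (fun k l => f (qf_coef q k l))) //.
  by apply: eq_bigr => k _; apply: eq_bigr => l _; rewrite !mxE !eqxx.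
rewrite -[RHS](sum_delta i j (fun k l => f (qf_coef q k l))) //.
rewrite /polar /= -!sumrB; apply: eq_bigr => k _.
rewrite -!sumrB; apply: eq_bigr => l kl; rewrite !mxE !eqxx /=.
have z : (k == j)%:R * (l == i)%:R = 0 :> S.
  case: eqP => [kj|]; last by rewrite mul0r.
  case: eqP => [li|]; last by rewrite mulr0.
  have : (i == j) by rewrite -val_eqE eqn_leq ij -li -kj kl.
  by rewrite (negPf nij).
by rewrite !mulrDl !mulrDr z; ring.
Qed.

Lemma qf_map_coef_eq (q : quadForm 'rV[R]_n) (q' : quadForm 'rV[S]_n) :
  (forall i j : 'I_n, (i <= j)%N -> f (qf_coef q i j) = qf_coef q' i j) ->
  qf_map q = q'.
Proof. by move=> e; apply: qf_eq_coef => i j ij; rewrite qf_map_coef ?e. Qed.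

End BaseChange.

(* q_k = \sum_i x_i y_i; the first k coordinates are the x_i, the last k the y_i. *)
Definition hyp_fun (R : comNzRingType) (k : nat) (v : 'rV[R]_(k + k)) : R :=
  \sum_(i < k) lsubmx v 0 i * rsubmx v 0 i.

Lemma hyp_subproof (R : comNzRingType) (k : nat) : is_quadform (@hyp_fun R k).
Proof.
apply: is_quadform_sum => i; split=> [a x|a x y z]; rewrite /polar !mxE.
  by rewrite expr2; ring.
by ring.
Qed.

Definition hyp (R : comNzRingType) (k : nat) : quadForm 'rV[R]_(k + k) :=
  QuadForm (@hyp_subproof R k).

Lemma hyp_map (R S : comNzRingType) (f : {rmorphism R -> S}) k (v : 'rV[R]_(k + k)) :
  hyp_fun (map_mx f v) = f (hyp_fun v).
Proof.
by rewrite rmorph_sum; apply: eq_bigr => i _; rewrite !mxE rmorphM.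
Qed.

Lemma hyp_comp_map (R S : comNzRingType) (f : {rmorphism R -> S}) n k
    (m : 'M[R]_(n, k + k)) :
  qf_map f (qf_comp (hyp R k) (mulmxr m)) = qf_comp (hyp S k) (mulmxr (map_mx f m)).
Proof.
apply: qf_map_coef_eq => i j _; rewrite /qf_coef /polar /=.
have rE a : delta_mx 0 a *m map_mx f m = map_mx f (delta_mx 0 a *m m).
  by rewrite map_mxM map_delta_mx.
rewrite !mulmxDl !rE -map_mxD.
by case: eqP => _; rewrite ?rmorphB !hyp_map.
Qed.

(* A vectType is a free module of finite rank (dim L) with a chosen isomorphism
   r2v from 'rV_(dim L).  Accordingly, for an algebra R, the R-module L (x) R
   is 'rV[R]_(dim L). *)
Section QuadLattice.
Import VectorInternalTheory.
Variables (p : nat) (K : padicField p) (F : fieldExtType K).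

Definition qf_coord (o : comNzRingType) (L : vectType o) (q : quadForm L) :
  quadForm 'rV[o]_(dim L) := qf_comp q (@r2v o L).

Record quadLattice := QuadLattice {
  lattice :> vectType (ringint F);
  lattice_form : quadForm lattice;
  lattice_nondeg : nondegenerate (qf_map (ringint_incl F) (qf_coord lattice_form))
}.

End QuadLattice.

(* An o-scheme X is given by its functor of points R |-> X(R) on commutative
   o-algebras R, and a morphism of o-schemes by a natural transformation.  The
   algebras are nonzero (comAlgType); nothing is lost since X(0) is a one-point
   set for every scheme X. *)
Section FunctorOfPoints.
Variable o : comNzRingType.

Record oFunctor := OFunctor {
  points :> comAlgType o -> Type;
  restr : forall R S : comAlgType o, {lrmorphism R -> S} -> points R -> points S;
  restr_id : forall (R : comAlgType o) (f : {lrmorphism R -> R}) (x : points R),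
    f =1 id -> restr f x = x;
  restr_comp : forall (R S T : comAlgType o) (f : {lrmorphism R -> S})
    (g : {lrmorphism S -> T}) (h : {lrmorphism R -> T}) (x : points R),
    h =1 g \o f -> restr h x = restr g (restr f x)
}.

Record oMorphism (X Y : oFunctor) := OMorphism {
  mor_fun :> forall R : comAlgType o, X R -> Y R;
  mor_nat : forall (R S : comAlgType o) (f : {lrmorphism R -> S}) (x : X R),
    mor_fun (restr f x) = restr f (mor_fun x)
}.

Definition unit_ideal (R : comNzRingType) (J : R -> Prop) : Prop :=
  exists s : seq (R * R), (forall ab, ab \in s -> J ab.2) /\
    \sum_(ab <- s) ab.1 * ab.2 = 1.

(* U is an open subfunctor of X: for every x in X(R), the locus of Spec R where
   x lies in U is the complement of the zero set of some set I of functions,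
   that is, the x-pullback of U consists of the maps f : R -> S such that f(I)
   generates the unit ideal of S. *)
Definition is_open (X : oFunctor) (U : forall R : comAlgType o, X R -> Prop) : Prop :=
  forall (R : comAlgType o) (x : X R), exists I : R -> Prop,
    forall (S : comAlgType o) (f : {lrmorphism R -> S}),
      U S (restr f x) <-> unit_ideal (fun b : S => exists2 a : R, I a & b = f a).

Definition open_immersion (Z X : oFunctor) (j : oMorphism Z X) : Prop :=
  (forall R : comAlgType o, injective (@mor_fun _ _ j R)) /\
  is_open (fun (R : comAlgType o) (x : X R) => exists z : Z R, j R z = x).

Lemma lrmorphism_ext (R S : comAlgType o) (f g : {lrmorphism R -> S}) :
  f =1 g -> f = g.
Proof.
case: f g => [f cf] [g cg] /= /funext fg; rewrite fg in cf *.
by congr GRing.LRMorphism.Pack; case: cf cg => [[a1] [b1] [c1]] [[a2] [b2] [c2]];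
  congr GRing.LRMorphism.Class; congr (_ _); apply: Prop_irrelevance.
Qed.

Section Spec.
Variable B : comAlgType o.

Definition spec_restr (R S : comAlgType o) (f : {lrmorphism R -> S})
  (x : {lrmorphism B -> R}) : {lrmorphism B -> S} := f \o x.

Lemma spec_id (R : comAlgType o) (f : {lrmorphism R -> R}) x :
  f =1 id -> spec_restr f x = x.
Proof. by move=> fE; apply: lrmorphism_ext => b; apply: fE. Qed.

Lemma spec_comp (R S T : comAlgType o) (f : {lrmorphism R -> S})
    (g : {lrmorphism S -> T}) (h : {lrmorphism R -> T}) x :
  h =1 g \o f -> spec_restr h x = spec_restr g (spec_restr f x).
Proof. by move=> hE; apply: lrmorphism_ext => b; apply: hE. Qed.

Definition Spec : oFunctor := OFunctor spec_id spec_comp.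

(* Spec of the finitely presented B-algebra B[x_1, .., x_m] / (g_1, .., g_r):
   an R-point is an R-point of Spec B with a solution in R^m of g = 0. *)
Variables (m r : nat) (g : 'I_r -> {mpoly B[m]}).

Record presPoint (R : comAlgType o) := PresPoint {
  pres_base : {lrmorphism B -> R};
  pres_coord : {ffun 'I_m -> R};
  pres_eqn : forall j : 'I_r, mmap pres_base pres_coord (g j) = 0
}.

Lemma presPoint_ext (R : comAlgType o) (x y : presPoint R) :
  pres_base x =1 pres_base y -> pres_coord x =1 pres_coord y -> x = y.
Proof.
case: x y => [a u e] [b v e'] /= /lrmorphism_ext ab /ffunP uv.
by case: b / ab e' => e'; case: v / uv e' => e'; congr PresPoint; apply: Prop_irrelevance.
Qed.

Lemma pres_restr_subproof (R S : comAlgType o) (f : {lrmorphism R -> S})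
    (x : presPoint R) (j : 'I_r) :
  mmap (f \o pres_base x) [ffun i => f (pres_coord x i)] (g j) = 0.
Proof.
rewrite -(rmorph0 f) -(pres_eqn x j) /mmap rmorph_sum; apply: eq_bigr => /= c _.
rewrite rmorphM /mmap1 rmorph_prod; congr (_ * _); apply: eq_bigr => i _.
by rewrite ffunE rmorphXn.
Qed.

Definition pres_restr (R S : comAlgType o) (f : {lrmorphism R -> S})
  (x : presPoint R) : presPoint S :=
  @PresPoint S (f \o pres_base x) _ (pres_restr_subproof f x).

Lemma pres_id (R : comAlgType o) (f : {lrmorphism R -> R}) x :
  f =1 id -> pres_restr f x = x.
Proof. by move=> fE; apply: presPoint_ext => i /=; rewrite ?ffunE fE. Qed.

Lemma pres_comp (R S T : comAlgType o) (f : {lrmorphism R -> S})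
    (h : {lrmorphism S -> T}) (k : {lrmorphism R -> T}) x :
  k =1 h \o f -> pres_restr k x = pres_restr h (pres_restr f x).
Proof. by move=> kE; apply: presPoint_ext => i /=; rewrite ?ffunE kE. Qed.

Definition SpecPres : oFunctor := OFunctor pres_id pres_comp.

End Spec.

(* Every point x of X (a point with values in a field) has an affine open
   neighbourhood u which rho maps into an affine open v = Spec B of Y, and
   which is the spectrum of a finitely presented B-algebra. *)
Definition locally_fin_pres (X Y : oFunctor) (rho : oMorphism X Y) : Prop :=
  forall (k : comAlgType o),
    (forall a : k, a != 0 -> exists b : k, a * b = 1) ->
  forall x : X k,
  exists (B : comAlgType o) (m r : nat) (g : 'I_r -> {mpoly B[m]})
    (u : oMorphism (SpecPres g) X) (v : oMorphism (Spec B) Y),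
    [/\ open_immersion u, open_immersion v,
        forall (R : comAlgType o) (z : SpecPres g R),
          rho R (u R z) = v R (pres_base z) &
        exists z : SpecPres g k, u k z = x].

(* Infinitesimal lifting along R ->> R0 = R / J with J nilpotent: every diagram
     Spec R0 --x0--> X
       |             | rho
     Spec R  --y --> Y     has a diagonal filler Spec R --> X. *)
Definition formally_smooth (X Y : oFunctor) (rho : oMorphism X Y) : Prop :=
  forall (R R0 : comAlgType o) (pi : {lrmorphism R -> R0}),
    (forall b : R0, exists a : R, pi a = b) ->
    (exists e : nat, forall a : 'I_e -> R,
       (forall i, pi (a i) = 0) -> \prod_(i < e) a i = 0) ->
  forall (y : Y R) (x0 : X R0), rho R0 x0 = restr pi y ->
  exists2 x : X R, restr pi x = x0 & rho R x = y.

(* EGA IV 17.3.1 *)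
Definition smooth (X Y : oFunctor) (rho : oMorphism X Y) : Prop :=
  formally_smooth rho /\ locally_fin_pres rho.

Section OpenSub.
Variables (X : oFunctor) (U : forall R : comAlgType o, X R -> Prop).
Arguments U {R}.
Hypothesis U_open : is_open (@U).

Lemma open_stable (R S : comAlgType o) (f : {lrmorphism R -> S}) (x : X R) :
  U x -> U (restr f x).
Proof.
have [I IP] := U_open x => Ux; apply/IP.
have /IP[s [sI s1]] : U (restr idfun x) by rewrite restr_id.
exists [seq (f ab.1, f ab.2) | ab <- s]; split.
  by move=> _ /mapP[ab /sI[a Ia /= e] ->]; exists a; rewrite //= e.
by rewrite big_map -(rmorph1 f) -s1 rmorph_sum; apply: eq_bigr => ab _; rewrite rmorphM.
Qed.

Definition open_points (R : comAlgType o) : Type := {x : X R | U x}.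

Definition open_restr (R S : comAlgType o) (f : {lrmorphism R -> S})
  (x : open_points R) : open_points S :=
  exist _ (restr f (sval x)) (open_stable f (svalP x)).

Lemma open_ext (R : comAlgType o) (x y : open_points R) : sval x = sval y -> x = y.
Proof.
by case: x y => [x Ux] [y Uy] /= e; subst y; congr exist; apply: Prop_irrelevance.
Qed.

Lemma open_id (R : comAlgType o) (f : {lrmorphism R -> R}) x :
  f =1 id -> open_restr f x = x.
Proof. by move=> fE; apply: open_ext; rewrite /= restr_id. Qed.

Lemma open_comp (R S T : comAlgType o) (f : {lrmorphism R -> S})
    (g : {lrmorphism S -> T}) (h : {lrmorphism R -> T}) x :
  h =1 g \o f -> open_restr h x = open_restr g (open_restr f x).
Proof. by move=> hE; apply: open_ext; rewrite /= (restr_comp _ hE). Qed.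

Definition openSub : oFunctor := OFunctor open_id open_comp.

End OpenSub.

Variables (L : vectType o) (k : nat).
Local Notation n := (dim L).

(* An R-linear map L (x) R -> H_k (x) R is given by its matrix m, acting by
   v |-> v *m m on row vectors. *)
Definition M_restr (R S : comAlgType o) (f : {lrmorphism R -> S})
  (m : 'M[R]_(n, k + k)) : 'M[S]_(n, k + k) := map_mx f m.

Lemma M_id (R : comAlgType o) (f : {lrmorphism R -> R}) m :
  f =1 id -> M_restr f m = m.
Proof. by move=> fE; apply/matrixP => i j; rewrite mxE fE. Qed.

Lemma M_comp (R S T : comAlgType o) (f : {lrmorphism R -> S})
    (g : {lrmorphism S -> T}) (h : {lrmorphism R -> T}) m :
  h =1 g \o f -> M_restr h m = M_restr g (M_restr f m).
Proof. by move=> hE; apply/matrixP => i j; rewrite !mxE hE. Qed.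

Definition Mfun : oFunctor := OFunctor M_id M_comp.

Definition minor (R : comNzRingType) (m : 'M[R]_(n, k + k)) (a : R) : Prop :=
  exists2 s : 'I_n -> 'I_(k + k),
    (forall i j : 'I_n, (i < j)%N -> (s i < s j)%N) & a = \det (colsub s m).

(* The open subscheme of M(L, H_k) where at least one n x n minor is
   invertible, i.e. the union of the loci where a given minor is invertible.
   For a local algebra R, its R-points are the m with at least one minor that
   is a unit of R (Mstar_local); for a general R this has to hold at every
   point of Spec R, i.e. the minors of m generate the unit ideal. *)
Definition Mstar_sub (R : comAlgType o) (m : Mfun R) : Prop := unit_ideal (minor m).

Lemma unit_ideal_eq (R : comNzRingType) (J J' : R -> Prop) :
  (forall a, J a <-> J' a) -> unit_ideal J <-> unit_ideal J'.
Proof.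
by move=> e; split=> -[s [sJ s1]]; exists s; split=> // ab /sJ /e.
Qed.

Lemma Mstar_open : is_open Mstar_sub.
Proof.
move=> R m; exists (minor m) => S f; apply: unit_ideal_eq => b.
split=> [[s s_lt ->]|[_ [s s_lt ->] ->]].
  by exists (\det (colsub s m)); [exists s|rewrite -det_map_mx map_mxsub].
by exists s; rewrite // -det_map_mx map_mxsub.
Qed.

Lemma Mstar_local (R : comAlgType o) (m : Mfun R) :
  (forall a b c : R, (a + b) * c = 1 -> exists d, a * d = 1 \/ b * d = 1) ->
  Mstar_sub m <-> exists2 a : R, minor m a & exists b : R, a * b = 1.
Proof.
move=> R_local; split=> [[s [sm s1]]|[a ma [b ab]]]; last first.
  exists [:: (b, a)]; split=> [_ /[!inE] /eqP -> //|].
  by rewrite big_seq1 mulrC.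
have {s1} : exists c, \sum_(ab <- s) ab.1 * ab.2 * c = 1.
  by exists 1; rewrite -[RHS]s1; apply: eq_bigr => ab _; rewrite mulr1.
elim: s sm => [|ab s IH] sm [c]; first by rewrite big_nil => /eqP; rewrite eq_sym oner_eq0.
rewrite big_cons -mulr_suml -mulrDl => /R_local[d [abd|sd]].
  by exists ab.2; [apply: sm; rewrite mem_head|exists (ab.1 * d); rewrite mulrCA mulrA].
apply: IH => [x xs|]; first by apply: sm; rewrite in_cons xs orbT.
by exists d; rewrite -mulr_suml.
Qed.

Definition Mstar : oFunctor := openSub Mstar_open.

Definition Q_restr (R S : comAlgType o) (f : {lrmorphism R -> S})
  (q : quadForm 'rV[R]_n) : quadForm 'rV[S]_n := qf_map f q.

Lemma Q_id (R : comAlgType o) (f : {lrmorphism R -> R}) q :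
  f =1 id -> Q_restr f q = q.
Proof. by move=> fE; apply: qf_map_coef_eq => i j _; exact: fE. Qed.

Lemma Q_comp (R S T : comAlgType o) (f : {lrmorphism R -> S})
    (g : {lrmorphism S -> T}) (h : {lrmorphism R -> T}) q :
  h =1 g \o f -> Q_restr h q = Q_restr g (Q_restr f q).
Proof.
by move=> hE; apply: qf_map_coef_eq => i j ij; rewrite !qf_map_coef //; exact: hE.
Qed.

Definition Qfun : oFunctor := OFunctor Q_id Q_comp.

Definition rho_fun (R : comAlgType o) (m : Mstar R) : Qfun R :=
  qf_comp (hyp R k) (mulmxr (sval m)).

Lemma rho_nat (R S : comAlgType o) (f : {lrmorphism R -> S}) (m : Mstar R) :
  rho_fun (restr f m) = restr f (rho_fun m).
Proof. exact/esym/hyp_comp_map. Qed.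

Definition rho : oMorphism Mstar Qfun := OMorphism rho_nat.

End FunctorOfPoints.

(* Main.v *)
Require Import Defs.
From HB Require Import structures.
From mathcomp Require Import all_boot all_order all_algebra all_field.
From mathcomp Require Import ring boolp.
From mathcomp.multinomials Require Import mpoly.

(* Formal smoothness: where the minors of [m] generate the unit ideal, Cramer's
   rule gives a right inverse of [m], and since the polar form of [q_k] is
   unimodular, every quadratic form is the value at some [d] of the differential
   [d |-> (v |-> B(v m, v d))] of [rho] at [m]; Newton iteration then lifts points
   along nilpotent thickenings.  Finite presentation: [Q_L] is the spectrum of a
   polynomial algebra [Qcoord], and the locus where a given minor of [m] is
   invertible is the spectrum of [Qcoord[m_ij, t]] modulo the equations
   [t * minor = 1] and [q_k o m = q], with [q] the universal form. *)

Set Implicit Arguments.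
Unset Strict Implicit.
Unset Printing Implicit Defensive.

Import GRing.Theory.
Local Open Scope ring_scope.

(** * The hyperbolic form in matrix terms, and its expansion at [m + d] *)

Definition hyp_gram (R : comNzRingType) k : 'M[R]_(k + k) :=
  block_mx 0 1%:M 1%:M 0.

(** The identity blocks swap the two halves, so the Gram matrix of the polar form is an involution
    over every ring: this is unimodularity. *)
Lemma hyp_gramK (R : comNzRingType) k : hyp_gram R k *m hyp_gram R k = 1%:M.
Proof.
by rewrite mulmx_block !mulmx0 !mul0mx !mulmx1 !addr0 !add0r -scalar_mx_block.
Qed.

Lemma hyp_gram_tr (R : comNzRingType) k : (hyp_gram R k)^T = hyp_gram R k.
Proof. by rewrite /hyp_gram tr_block_mx !trmx0 !trmx1. Qed.

Lemma polar_hyp (R : comNzRingType) k (x y : 'rV[R]_(k + k)) :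
  polar (hyp R k) x y = (x *m hyp_gram R k *m y^T) 0 0.
Proof.
rewrite -[x in RHS]hsubmxK -[y in RHS]hsubmxK mul_row_block tr_row_mx mul_row_col.
rewrite !mulmx0 !mulmx1 add0r addr0 !mxE -big_split /= /polar /= /hyp_fun.
rewrite -!sumrB; apply: eq_bigr => i _; rewrite !mxE; ring.
Qed.

Definition mx_polar (R : comNzRingType) n k (m d : 'M[R]_(n, k + k)) : 'M[R]_n :=
  m *m hyp_gram R k *m d^T.

Lemma mx_polarE (R : comNzRingType) n k (m d : 'M[R]_(n, k + k)) i j :
  mx_polar m d i j = polar (hyp R k) (row i m) (row j d).
Proof.
by rewrite polar_hyp tr_row -row_mul !mxE; apply: eq_bigr => l _; rewrite !mxE.
Qed.

(** [rho_fun] freed from the condition on minors, so that Newton iteration can run on arbitrary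
    matrices. *)
Definition mform (R : comNzRingType) n k (m : 'M[R]_(n, k + k)) :
  quadForm 'rV[R]_n := qf_comp (hyp R k) (mulmxr m).

Lemma mform_coef (R : comNzRingType) n k (m : 'M[R]_(n, k + k)) i j :
  qf_coef (mform m) i j = if i == j then hyp_fun (row i m) else mx_polar m m i j.
Proof.
by rewrite mx_polarE /qf_coef /polar /= mulmxDl -!rowE; case: eqP.
Qed.

Lemma mx_polarC (R : comNzRingType) n k (m d : 'M[R]_(n, k + k)) :
  mx_polar m d = (mx_polar d m)^T.
Proof. by rewrite /mx_polar !trmx_mul hyp_gram_tr trmxK mulmxA. Qed.

(** The last summand is the differential at [m] applied to [d]; on the diagonal it carries no factor
    2. *)
Lemma mform_coefD (R : comNzRingType) n k (m d : 'M[R]_(n, k + k)) i j :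
  qf_coef (mform (m + d)) i j = qf_coef (mform m) i j + qf_coef (mform d) i j +
    if i == j then mx_polar m d i i else mx_polar m d i j + mx_polar m d j i.
Proof.
rewrite !mform_coef; case: eqP => _.
  by rewrite raddfD mx_polarE; apply: (qfD (hyp R k)).
have -> : mx_polar m d j i = mx_polar d m i j by rewrite mx_polarC mxE.
rewrite /mx_polar !(mulmxDl, raddfD, mulmxDr) /= !mxE; ring.
Qed.

(** * Nilpotent thickenings and Newton iteration *)

Section Nilpotent.
Variables (R R0 : comNzRingType) (pi : {rmorphism R -> R0}).

(* With [J = ker pi]: the part of [J] that is killed by [J ^ e]; it stands in
   for the powers of [J], in the opposite order. *)
Definition ker_ann (e : nat) (a : R) : Prop :=
  pi a = 0 /\
  forall b : 'I_e -> R, (forall i, pi (b i) = 0) -> a * \prod_(i < e) b i = 0.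

Lemma ker_ann0 e : ker_ann e 0.
Proof. by split=> [|b _]; rewrite ?rmorph0 ?mul0r. Qed.

Lemma ker_annD e a b : ker_ann e a -> ker_ann e b -> ker_ann e (a + b).
Proof.
move=> [pa aJ] [pb bJ]; split=> [|c cJ]; first by rewrite rmorphD pa pb addr0.
by rewrite mulrDl aJ // bJ // addr0.
Qed.

Lemma ker_annMl e a b : ker_ann e b -> ker_ann e (a * b).
Proof.
move=> [pb bJ]; split=> [|c cJ]; first by rewrite rmorphM pb mulr0.
by rewrite -mulrA bJ // mulr0.
Qed.

Lemma ker_annN e a : ker_ann e a -> ker_ann e (- a).
Proof. by rewrite -mulN1r; apply: ker_annMl. Qed.

Lemma ker_ann_sum e (I : Type) (r : seq I) (P : pred I) (a : I -> R) :
  (forall i, ker_ann e (a i)) -> ker_ann e (\sum_(i <- r | P i) a i).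
Proof.
move=> aJ; apply: (big_ind (ker_ann e)) => //; first exact: ker_ann0.
exact: ker_annD.
Qed.

(** The factor [a] joins [e] elements of [ker pi] to make the [e.+1] factors that kill [b]. *)
Lemma ker_annS e a b : pi a = 0 -> ker_ann e.+1 b -> ker_ann e (a * b).
Proof.
move=> pa [pb bJ]; split=> [|c cJ]; first by rewrite rmorphM pb mulr0.
pose c' (i : 'I_e.+1) := oapp c a (unlift ord0 i).
have := bJ c'; rewrite big_ord_recl /c' unlift_none /=.
under eq_bigr do rewrite liftK /=.
by rewrite mulrCA mulrA; apply=> i; case: unliftP => [j _|_] /=.
Qed.

Lemma ker_ann_eq0 a : ker_ann 0 a -> a = 0.
Proof. by move=> [_ /(_ (fun=> 0))]; rewrite big_ord0 mulr1; apply=> -[]. Qed.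

Lemma ker_ann_ker e a :
  (forall b : 'I_e -> R, (forall i, pi (b i) = 0) -> \prod_(i < e) b i = 0) ->
  pi a = 0 -> ker_ann e a.
Proof. by move=> nilJ pa; split=> // b /nilJ ->; rewrite mulr0. Qed.

Lemma ker_ann_mulmx e m n p (A : 'M[R]_(m, n)) (B : 'M[R]_(n, p)) :
  (forall i j, ker_ann e (B i j)) -> forall i j, ker_ann e ((A *m B) i j).
Proof. by move=> BJ i j; rewrite mxE; apply: ker_ann_sum => l; apply: ker_annMl. Qed.

Lemma ker_annS_mulmx e m n p (A : 'M[R]_(m, n)) (B : 'M[R]_(n, p)) :
  (forall i j, pi (A i j) = 0) -> (forall i j, ker_ann e.+1 (B i j)) ->
  forall i j, ker_ann e ((A *m B) i j).
Proof. by move=> AJ BJ i j; rewrite mxE; apply: ker_ann_sum => l; apply: ker_annS. Qed.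

(** Coefficients are sums of products of two entries of [d]; one factor lies in [ker pi] and lowers
    the index of the other. *)
Lemma ker_ann_mform e n k (d : 'M[R]_(n, k + k)) :
  (forall i j, ker_ann e.+1 (d i j)) ->
  forall i j, ker_ann e (qf_coef (mform d) i j).
Proof.
move=> dJ i j; rewrite mform_coef; case: eqP => _.
  apply: ker_ann_sum => l; rewrite !mxE; apply: ker_annS => //.
  by case: (dJ i (lshift k l)).
rewrite /mx_polar -mulmxA; apply: ker_annS_mulmx => [a b|]; first by case: (dJ a b).
by apply: ker_ann_mulmx => a b; rewrite mxE.
Qed.

(* Newton iteration.  As [m *m N = 1] modulo [J], the differential
   [d |-> mx_polar m d] of [mform] at [m] is onto modulo [J], with section
   [E |-> E^T *m N^T *m hyp_gram]; the residual [q - mform m] thus moves from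
   [ker_ann e.+1] to [ker_ann e] at each step. *)
Lemma mform_lift n k (N : 'M[R]_(k + k, n)) (q : quadForm 'rV[R]_n) e
    (m : 'M[R]_(n, k + k)) :
  (forall i j, pi ((m *m N - 1%:M) i j) = 0) ->
  (forall i j : 'I_n, (i <= j)%N ->
     ker_ann e (qf_coef q i j - qf_coef (mform m) i j)) ->
  exists2 m' : 'M[R]_(n, k + k), map_mx pi m' = map_mx pi m & mform m' = q.
Proof.
elim: e m => [|e IH] m mN mq.
  exists m => //; apply: qf_eq_coef => i j ij.
  by apply/esym/eqP; rewrite -subr_eq0; apply/eqP/ker_ann_eq0/mq.
(* Stored as upper triangular, the residual has coefficients [E i i] and [E i j + E j i], the shape
   of the linear term in [mform_coefD]. *)
pose E : 'M[R]_n := \matrix_(i, j)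
  if (i <= j)%N then qf_coef q i j - qf_coef (mform m) i j else 0.
have EJ i j : ker_ann e.+1 (E i j).
  by rewrite mxE; case: ifP => [/mq //|_]; apply: ker_ann0.
(* Chosen so that [mx_polar m d = m *m N *m E], which is [E] up to an error with a factor in
   [ker pi]. *)
pose d := (hyp_gram R k *m (N *m E))^T.
have dJ i j : ker_ann e.+1 (d i j).
  by rewrite mxE; do 2!apply: ker_ann_mulmx => ??.
have pd : map_mx pi d = 0 by apply/matrixP => i j; rewrite mxE [RHS]mxE; case: (dJ i j).
(* As [d] vanishes under [pi], the same [N] serves for [m + d]. *)
have [||m' m'm <-] := IH (m + d); last by exists m'; rewrite // m'm map_mxD pd addr0.
- move=> i j; rewrite mulmxDl addrAC mxE rmorphD mN add0r.
  have := congr1 (fun A : 'M_n => A i j) (map_mxM pi d N).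
  by rewrite pd mul0mx mxE [RHS]mxE.
have PE : mx_polar m d = E + (m *m N - 1%:M) *m E.
  rewrite /mx_polar trmxK -mulmxA [hyp_gram R k *m _]mulmxA hyp_gramK mul1mx.
  by rewrite mulmxBl mul1mx addrC subrK mulmxA.
have WJ : forall i j, ker_ann e (((m *m N - 1%:M) *m E) i j) by apply: ker_annS_mulmx.
move=> i j ij; rewrite mform_coefD PE.
set W := _ *m E in WJ *.
have -> : qf_coef q i j = qf_coef (mform m) i j + E i j.
  by rewrite mxE ij addrC subrK.
have dq i' j' := ker_annN (ker_ann_mform dJ i' j').
case: eqP => [<-|/eqP nij].
  rewrite [(E + W) i i]mxE.
  set a := qf_coef _ _ _; set b := qf_coef (mform d) _ _.
  have -> : a + E i i - (a + b + (E i i + W i i)) = - b - W i i by ring.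
  by apply: ker_annD; [apply: dq | apply: ker_annN].
have Eji : E j i = 0 by rewrite mxE leqNgt ltn_neqAle ij andbT (inj_eq val_inj) nij.
rewrite ![(E + W) _ _]mxE Eji add0r.
set a := qf_coef _ _ _; set b := qf_coef (mform d) _ _.
have -> : a + E i j - (a + b + (E i j + W i j + W j i)) = - b - W i j - W j i by ring.
by apply: ker_annD; [apply: ker_annD; [apply: dq | apply: ker_annN] | apply: ker_annN].
Qed.

(** Geometric series in [1 - a], which lies in [ker pi]. *)
Lemma ker_nil_unit e a :
  (forall b : 'I_e -> R, (forall i, pi (b i) = 0) -> \prod_(i < e) b i = 0) ->
  pi a = 1 -> exists b, b * a = 1.
Proof.
move=> nilJ pa; exists (\sum_(i < e) (1 - a) ^+ i).
have := subrX1 (1 - a) e; have -> : (1 - a) ^+ e = 0.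
  have := nilJ (fun=> 1 - a); rewrite prodr_const card_ord; apply=> _.
  by rewrite rmorphB rmorph1 pa subrr.
by rewrite sub0r addrAC subrr sub0r mulNr mulrC => /oppr_inj.
Qed.

End Nilpotent.

(** * Minors, right inverses and formal smoothness *)

Section Smoothness.
Import VectorInternalTheory.
Variables (o : comNzRingType) (L : vectType o) (k : nat).
Local Notation n := (dim L).

Lemma minor_mulmx (R : comNzRingType) (m : 'M[R]_(n, k + k)) a :
  minor m a -> exists N : 'M[R]_(k + k, n), m *m N = a%:M.
Proof.
(* Right multiplication by [colsub s 1%:M] selects the columns [s] of [m]. *)
case=> s _ ->; exists (colsub s 1%:M *m \adj (colsub s m)).
by rewrite mulmxA mulmx_colsub mulmx1 mul_mx_adj.
Qed.

(** The relation writing 1 through minors combines their Cramer matrices into a right inverse. *)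
Lemma unit_minors_mulmx (R : comNzRingType) (m : 'M[R]_(n, k + k)) :
  unit_ideal (minor m) -> exists N : 'M[R]_(k + k, n), m *m N = 1%:M.
Proof.
move=> [s [sm <-]]; elim: s sm => [|ab s IH] sm.
  by exists 0; rewrite mulmx0 big_nil raddf0.
have [x xs|N mN] := IH; first by apply: sm; rewrite in_cons xs orbT.
have [N1 mN1] := minor_mulmx (sm ab (mem_head _ _)).
exists (ab.1 *: N1 + N); rewrite mulmxDr mN -scalemxAr mN1 big_cons.
by rewrite scale_scalar_mx raddfD.
Qed.

(** With lifted coefficients, the same minors of [m] combine to an element over 1; it is a unit, and
    dividing by it gives 1. *)
Lemma unit_minors_lift (R R0 : comNzRingType) (pi : {rmorphism R -> R0})
    (m : 'M[R]_(n, k + k)) :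
  (forall b : R0, exists a : R, pi a = b) ->
  (forall a, pi a = 1 -> exists b, b * a = 1) ->
  unit_ideal (minor (map_mx pi m)) -> unit_ideal (minor m).
Proof.
move=> pi_surj pi_unit [s [sm s1]].
suff [s' sm' s'E] : exists2 s' : seq (R * R), forall ab, ab \in s' -> minor m ab.2
    & pi (\sum_(ab <- s') ab.1 * ab.2) = \sum_(ab <- s) ab.1 * ab.2.
  have [|b bs] := pi_unit (\sum_(ab <- s') ab.1 * ab.2); first by rewrite s'E.
  exists [seq (b * ab.1, ab.2) | ab <- s']; split.
    by move=> _ /mapP[ab /sm' mab ->].
  by rewrite big_map -bs mulr_sumr; apply: eq_bigr => ab _; rewrite /= mulrA.
elim: s sm {s1} => [|ab s IH] sm; first by exists [::]; rewrite ?big_nil ?rmorph0.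
have [x xs|s' sm' s'E] := IH; first by apply: sm; rewrite in_cons xs orbT.
have [t t_lt abE] := sm ab (mem_head _ _); have [a aE] := pi_surj ab.1.
exists ((a, \det (colsub t m)) :: s').
  by move=> x /[!in_cons] /orP[/eqP -> /=|/sm' //]; exists t.
by rewrite !big_cons rmorphD s'E rmorphM aE abE -det_map_mx map_mxsub.
Qed.

Lemma rho_formally_smooth : formally_smooth (rho L k).
Proof.
move=> R R0 pi pi_surj [e nilJ] y [m0 Um0] /= m0y.
(* Only a set-theoretic section of [pi]; the lifts satisfy the required equations modulo [ker pi],
   which suffices to start the iteration. *)
have [g gK] := choice pi_surj.
have pig (a b : nat) (A : 'M[R0]_(a, b)) : map_mx pi (map_mx g A) = A.
  by apply/matrixP => i j; rewrite !mxE gK.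
have [N0 mN0] := unit_minors_mulmx Um0.
have [|i j ij|m pm my] := @mform_lift _ _ pi n k (map_mx g N0) y e (map_mx g m0).
- move=> i j; have : map_mx pi (map_mx g m0 *m map_mx g N0 - 1%:M) = 0.
    by rewrite map_mxB map_mxM !pig mN0 map_mx1 subrr.
  by move/(congr1 (fun A : 'M_n => A i j)); rewrite mxE [RHS]mxE.
- apply: ker_ann_ker nilJ _; rewrite rmorphB -!qf_map_coef // -[qf_map pi y]m0y.
  by rewrite hyp_comp_map pig subrr.
have Um : Mstar_sub (m : Mfun L k R).
  apply: (unit_minors_lift (pi := pi)) => //; last by rewrite pm pig.
  by move=> a; apply: ker_nil_unit nilJ.
by exists (exist _ m Um) => //; apply: open_ext; rewrite /= /M_restr pm pig.
Qed.

(** * Polynomial coordinates on the space of quadratic forms *)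

(* [row_mx 1 E] has rows [(e_i, E_i)], so [hyp] takes it to the form with upper
   triangular coefficient matrix [E]. *)
Definition form_of_coef (R : comNzRingType) d (c : 'I_d -> 'I_d -> R) :
    quadForm 'rV[R]_d :=
  mform (row_mx 1%:M (\matrix_(i, j) if (i <= j)%N then c i j else 0)).

Lemma form_of_coefE (R : comNzRingType) d (c : 'I_d -> 'I_d -> R) (i j : 'I_d) :
  (i <= j)%N -> qf_coef (form_of_coef c) i j = c i j.
Proof.
move=> ij; rewrite mform_coef /mx_polar mul_row_block tr_row_mx mul_row_col.
rewrite !mulmx0 !mulmx1 add0r addr0 trmx1 mulmx1 mul1mx /hyp_fun.
case: eqP => [<-|/eqP nij].
  rewrite (bigD1 i) //= big1 => [|l li];
    rewrite !mxE (unsplitK (inl _)) (unsplitK (inr _)) /= !mxE.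
    by rewrite eqxx leqnn mul1r addr0.
  by rewrite eq_sym (negPf li) mul0r.
by rewrite !mxE ij leqNgt ltn_neqAle ij andbT (inj_eq val_inj) nij addr0.
Qed.

Lemma mpoly_point N (R : comAlgType o) (h : 'I_N -> R) :
  exists b : {lrmorphism {mpoly o[N]} -> R}, forall i, b 'X_i = h i.
Proof.
pose b : {rmorphism {mpoly o[N]} -> R} := mmap (in_alg R) h.
have bZ : scalable b by move=> c x; rewrite /b /= mmapZ /= mulr_algl.
pose bZm := GRing.isScalable.Build _ _ _ _ b bZ.
pose bL : {lrmorphism {mpoly o[N]} -> R} := HB.pack (b : _ -> _) b bZm.
by exists bL => i; rewrite /= mmapX mmap1U.
Qed.

Lemma mpoly_point_ext N (R : comAlgType o) (b b' : {lrmorphism {mpoly o[N]} -> R}) :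
  (forall i, b 'X_i = b' 'X_i) -> b = b'.
Proof.
move=> bX; apply: lrmorphism_ext => x; rewrite [x]mpolyE !linear_sum.
apply: eq_bigr => m _; rewrite !linearZ mpolyXE_id !rmorph_prod.
by congr (_ *: _); apply: eq_bigr => i _; rewrite !rmorphXn; congr (_ ^+ _); apply: bX.
Qed.

Lemma bij_open_immersion (Z X : oFunctor o) (j : oMorphism Z X) :
  (forall R, injective (@mor_fun _ _ _ j R)) ->
  (forall R (x : X R), exists z : Z R, j R z = x) -> open_immersion j.
Proof.
move=> j_inj j_surj; split=> // R x; exists (fun a => a = 1) => S f.
split=> // _; exists [:: (1, 1)]; split; last by rewrite big_seq1 mulr1.
by move=> _ /[!inE] /eqP -> /=; exists 1; rewrite ?rmorph1.
Qed.

Lemma yoneda_nat (X : oFunctor o) (B : comAlgType o) (x : X B) (R S : comAlgType o)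
    (f : {lrmorphism R -> S}) (z : Spec B R) :
  @restr _ X B S (spec_restr f z) x = restr f (restr z x).
Proof. exact: restr_comp. Qed.

Definition yoneda (X : oFunctor o) (B : comAlgType o) (x : X B) :
  oMorphism (Spec B) X := OMorphism (yoneda_nat x).

(** Indexes the [n(n+1)/2] coefficients of a quadratic form, hence the coordinates of [Qfun]. *)
Definition upper : Type := {ij : 'I_n * 'I_n | (ij.1 <= ij.2)%N}.
HB.instance Definition _ := Finite.on upper.

Definition Qcoord : comAlgType o := {mpoly o[#|{: upper}|]}.

(** The default 0 is never read: [form_of_coef] consults only [i <= j], where [insub] succeeds. *)
Definition Quniv : Qfun L Qcoord :=
  form_of_coef (fun i j => oapp (fun t : upper => 'X_(enum_rank t)) 0 (insub (i, j))).

Lemma Quniv_coef (t : upper) :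
  qf_coef Quniv (val t).1 (val t).2 = 'X_(enum_rank t).
Proof. by rewrite form_of_coefE ?(valP t) // -surjective_pairing valK. Qed.

Lemma Quniv_mapP (R : comAlgType o) (b : {lrmorphism Qcoord -> R})
    (q : quadForm 'rV[R]_n) :
  (forall a : 'I_#|{: upper}|,
     b 'X_a = qf_coef q (val (enum_val a)).1 (val (enum_val a)).2)
  <-> qf_map b Quniv = q.
Proof.
split=> [bq|<- a].
  apply: qf_map_coef_eq => i j ij; pose t : upper := exist _ (i, j) ij.
  rewrite -[i]/(val t).1 -[j]/(val t).2 Quniv_coef.
  by apply: etrans (bq _) _; rewrite enum_rankK.
by rewrite qf_map_coef ?Quniv_coef ?enum_valK //; apply: (valP (enum_val a)).
Qed.

Lemma Quniv_open_immersion : open_immersion (yoneda Quniv).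
Proof.
apply: bij_open_immersion => R => [b b' /Quniv_mapP bX|q].
  apply: mpoly_point_ext => a; apply: etrans (bX a) _; apply/esym.
  by move: a; apply/Quniv_mapP.
have [b bX] := mpoly_point (R := R)
  (fun a : 'I_#|{: upper}| => qf_coef q (val (enum_val a)).1 (val (enum_val a)).2).
by exists b; apply/Quniv_mapP.
Qed.

(** * The chart where one given minor is invertible *)

Section Chart.
Variable s : 'I_n -> 'I_(k + k).
Hypothesis s_lt : forall i j : 'I_n, (i < j)%N -> (s i < s j)%N.

Local Notation entry := ('I_n * 'I_(k + k))%type.
Local Notation nvars := #|{: entry}|.+1.

(* Coordinate [ord0] is the inverse of the minor, the others are the entries of
   the matrix. *)
Definition coord_mx (R : Type) (h : 'I_nvars -> R) : 'M[R]_(n, k + k) :=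
  \matrix_(i, j) h (lift ord0 (enum_rank ((i, j) : entry))).

Definition chart_mx : 'M[{mpoly Qcoord[nvars]}]_(n, k + k) :=
  coord_mx (fun i => 'X_i).

(** Equation [ord0] inverts the minor; the others make the structure map to [Spec Qcoord] agree with
    [rho]. *)
Definition chart_eqn (a : 'I_#|{: upper}|.+1) : {mpoly Qcoord[nvars]} :=
  if unlift ord0 a is Some b then
    let ij := val (enum_val b) in
    qf_coef (mform chart_mx) ij.1 ij.2 - (qf_coef Quniv ij.1 ij.2)%:MP
  else 'X_ord0 * \det (colsub s chart_mx) - 1.

Lemma chart_eqnP (R : comAlgType o) (b : {lrmorphism Qcoord -> R})
    (h : 'I_nvars -> R) :
  (forall a, mmap b h (chart_eqn a) = 0) <->
  h ord0 * \det (colsub s (coord_mx h)) = 1 /\ mform (coord_mx h) = qf_map b Quniv.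
Proof.
pose ev : {rmorphism {mpoly Qcoord[nvars]} -> R} := mmap b h.
have evX i : ev 'X_i = h i by rewrite /ev /= mmapX mmap1U.
have evC c : ev c%:MP = b c by rewrite /ev /= mmapC.
have ev_mx : map_mx ev chart_mx = coord_mx h.
  by apply/matrixP => i j; rewrite !mxE evX.
have ev0 : ev (chart_eqn ord0) = h ord0 * \det (colsub s (coord_mx h)) - 1.
  rewrite /chart_eqn unlift_none rmorphB rmorphM rmorph1 evX -det_map_mx.
  by rewrite map_mxsub ev_mx.
have evS (c : 'I_#|{: upper}|) : let ij := val (enum_val c) in
    ev (chart_eqn (lift ord0 c)) =
    qf_coef (mform (coord_mx h)) ij.1 ij.2 - qf_coef (qf_map b Quniv) ij.1 ij.2.
  have ij := valP (enum_val c).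
  rewrite /chart_eqn liftK rmorphB evC qf_map_coef // -[ev _]qf_map_coef //.
  by rewrite hyp_comp_map ev_mx.
split=> [e|[e0 eS] a].
  split; first by apply/eqP; rewrite -subr_eq0 -ev0; apply/eqP/e.
  apply: qf_eq_coef => i j ij; pose t : upper := exist _ (i, j) ij.
  apply/eqP; rewrite -subr_eq0; have := evS (enum_rank t).
  by rewrite enum_rankK /= => <-; apply/eqP/e.
rewrite -[mmap b h _]/(ev _); case: (unliftP ord0 a) => [c|] ->.
  by rewrite evS eS subrr.
by rewrite ev0 e0 subrr.
Qed.

Lemma chart_subproof (R : comAlgType o) (z : SpecPres chart_eqn R) :
  Mstar_sub (coord_mx (pres_coord z) : Mfun L k R).
Proof.
have [e _] := (chart_eqnP _ _).1 (pres_eqn z).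
exists [:: (pres_coord z ord0, \det (colsub s (coord_mx (pres_coord z))))].
split; last by rewrite big_seq1.
by move=> _ /[!inE] /eqP -> /=; exists s.
Qed.

Definition chart_fun (R : comAlgType o) (z : SpecPres chart_eqn R) : Mstar L k R :=
  exist _ _ (chart_subproof z).

Lemma chart_nat (R S : comAlgType o) (f : {lrmorphism R -> S})
    (z : SpecPres chart_eqn R) :
  chart_fun (restr f z) = restr f (chart_fun z).
Proof. by apply: open_ext; apply/matrixP => i j; rewrite !mxE ffunE. Qed.

Definition chart : oMorphism (SpecPres chart_eqn) (Mstar L k) :=
  OMorphism chart_nat.

Lemma chart_rho (R : comAlgType o) (z : SpecPres chart_eqn R) :
  rho L k R (chart R z) = yoneda Quniv R (pres_base z).
Proof. by have [] := (chart_eqnP _ _).1 (pres_eqn z). Qed.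

(** The matrix determines the base point through [rho], as [yoneda Quniv] is injective, and the
    coordinate [ord0] by uniqueness of inverses. *)
Lemma chart_inj (R : comAlgType o) : injective (@mor_fun _ _ _ chart R).
Proof.
move=> z z' zz'; have bb : pres_base z = pres_base z'.
  by apply: Quniv_open_immersion.1; rewrite -!chart_rho zz'.
have [e _] := (chart_eqnP _ _).1 (pres_eqn z).
have [e' _] := (chart_eqnP _ _).1 (pres_eqn z').
have mm : coord_mx (pres_coord z) = coord_mx (pres_coord z').
  exact: (congr1 sval zz').
apply: presPoint_ext => [x|i]; first by rewrite bb.
case: (unliftP ord0 i) => [c|] ->.
  rewrite -[c]enum_valK; case: (enum_val c) => a1 a2.
  by have := congr1 (fun m : 'M_(n, k + k) => m a1 a2) mm; rewrite !mxE.
by rewrite -[LHS]mulr1 -e' -mm mulrCA e mulr1.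
Qed.

Lemma chart_image (R : comAlgType o) (x : Mstar L k R) :
  (exists z, chart R z = x) <-> exists t, t * \det (colsub s (sval x)) = 1.
Proof.
split=> [[z <-]|[t te]].
  by exists (pres_coord z ord0); have [] := (chart_eqnP _ _).1 (pres_eqn z).
pose h : {ffun 'I_nvars -> R} := [ffun i => oapp (fun c : 'I_nvars.-1 =>
  sval x (enum_val c).1 (enum_val c).2) t (unlift ord0 i)].
have hx : coord_mx h = sval x.
  by apply/matrixP => i j; rewrite mxE ffunE liftK /= enum_rankK.
(* The base point must be the one classifying the form of [sval x]. *)
have [b bX] := mpoly_point (R := R)
  (fun a : 'I_#|{: upper}| =>
     qf_coef (mform (sval x)) (val (enum_val a)).1 (val (enum_val a)).2).
have hP : forall a, mmap b h (chart_eqn a) = 0.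
  apply/chart_eqnP; rewrite hx ffunE unlift_none; split=> //.
  by apply/esym/Quniv_mapP.
by exists (PresPoint hP); apply: open_ext.
Qed.

Lemma chart_open_immersion : open_immersion chart.
Proof.
split=> [|R x]; first exact: chart_inj.
exists (fun a => a = \det (colsub s (sval x))) => S f.
have detE : \det (colsub s (sval (restr f x))) = f (\det (colsub s (sval x))).
  by rewrite /= -det_map_mx map_mxsub.
rewrite chart_image detE; split=> [[t te]|[r [rI r1]]].
  exists [:: (t, f (\det (colsub s (sval x))))]; rewrite big_seq1; split=> //.
  by move=> _ /[!inE] /eqP -> /=; exists (\det (colsub s (sval x))).
(* All second components in the relation equal the minor, so the coefficients sum to its inverse. *)
exists (\sum_(ab <- r) ab.1); rewrite mulr_suml -r1.
by apply: eq_big_seq => ab /rI[_ -> ->].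
Qed.

End Chart.

(** * Local finite presentation and smoothness *)

Lemma rho_locally_fin_pres : locally_fin_pres (rho L k).
Proof.
move=> R R_field x.
have [s s_lt s0] : exists2 s : 'I_n -> 'I_(k + k),
    forall i j : 'I_n, (i < j)%N -> (s i < s j)%N & \det (colsub s (sval x)) != 0.
  (* If all minors vanished at [x], the relation expressing 1 through them would read [0 = 1]. *)
  apply: contrapT => no_minor; have [r [rm r1]] := svalP x.
  have /eqP := oner_neq0 R; apply; rewrite -r1 big_seq big1 // => ab /rm[s s_lt ->].
  have [->|s0] := eqVneq (\det (colsub s (sval x))) 0; first by rewrite mulr0.
  by case: no_minor; exists s.
exists Qcoord, _, _, (chart_eqn s), (chart s_lt), (yoneda Quniv).
split; [exact: chart_open_immersion|exact: Quniv_open_immersion|exact: chart_rho|].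
by apply/chart_image; have [t te] := R_field _ s0; exists t; rewrite mulrC.
Qed.

End Smoothness.

Theorem theorem3p9 (p : nat) (p_prime : prime p)
    (K : padicField p) (F : fieldExtType K) (L : quadLattice F) (n k : nat)
    (L_rank : dim L = n) (n_le_k : (n <= k)%N) :
  smooth (rho L k).
Proof. by split; [apply: rho_formally_smooth | apply: rho_locally_fin_pres]. Qed.
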